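(* Let $(X,+,d)$ and $(Y,+,\rho)$ be metric abelian groups such that $X$ is uniquely 2-divisible and $2X$ is unbounded by $d$. Let $\varphi\colon[0,\infty)\to\mathbb{R}$ be such that $\lim_{t\to\infty}\varphi(t)=\infty$, and let $f\colon X\to Y$ satisfy $$\limsup_{\min(\|x\|_d,\|y\|_d)\to\infty}\varphi(\|x-y\|_d)\cdot\Big\|2f\Big(\frac{x+y}{2}\Big)-f(x)-f(y)\Big\|_\rho<\infty.$$ Then $$4f\Big(\frac{x+y}{2}\Big)=2f(x)+2f(y)\qquad\text{for all }x,y\in X.$$
   Context: A metric abelian group is a triple $(X,+,d)$ where $(X,+)$ is an abelian group and $d$ is a translation invariant metric on $X$ (i.e. $d(x+z,y+z)=d(x,y)$ for all $x,y,z\in X$). Write $\|x\|_d:=d(x,0)$; this is an even subadditive function on $X$, not necessarily positively homogeneous. $2X:=\{x+x: x\in X\}$, and ''$2X$ is unbounded by $d$'' means $\sup_{x\in X}\|2x\|_d=\infty$. $X$ is uniquely 2-divisible if for every $x\in X$ there is a unique $z\in X$ with $2z:=z+z=x$; this $z$ is denoted $\frac{x}{2}$. For a real-valued function $F$ on $X\times X$, $\limsup_{\min(\|x\|_d,\|y\|_d)\to\infty}F(x,y)$ denotes $\inf_{r>0}\sup\{F(x,y): x,y\in X,\ \|x\|_d\geq r,\ \|y\|_d\geq r\}$ in the extended reals. *)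

(* Defs.v *)
From mathcomp Require Import all_boot all_order all_algebra.
From mathcomp Require Import all_classical all_reals all_analysis.

Set Implicit Arguments.
Unset Strict Implicit.
Unset Printing Implicit Defensive.

Import Order.TTheory GRing.Theory Num.Theory.

Local Open Scope classical_set_scope.
Local Open Scope ring_scope.

(* A metric abelian group is a zmodType X together with a distance d satisfying
   [metric_group d]. The first four fields are those of the factory [isMetric].
   The library has no join of [metricType] and [zmodType], and
   [normedZmodType] is too strong, since it requires `|x *+ n| = `|x| *+ n. *)
Record metric_group (R : realType) (X : zmodType) (d : X -> X -> R) : Prop := {
  dist_xx : forall x, d x x = 0;
  dist_positivity : forall x y, d x y = 0 -> x = y;
  dist_sym : forall x y, d x y = d y x;
  dist_triangle : forall y x z, d x z <= d x y + d y z;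
  dist_translation : forall z x y, d (x + z) (y + z) = d x y
}.

Section MetricGroup.
Context {R : realType} {X : zmodType} (d : X -> X -> R).

Definition dnorm (x : X) : R := d x 0.

Definition double_unbounded : Prop :=
  ereal_sup [set (dnorm (x *+ 2))%:E | x in [set: X]] = +oo%E.

(* The upper limit of F x y as min (dnorm x) (dnorm y) tends to infinity. *)
Definition limsup_min_dnorm (F : X -> X -> R) : \bar R :=
  ereal_inf [set ereal_sup [set (F p.1 p.2)%:E |
                   p in [set p : X * X | r <= dnorm p.1 /\ r <= dnorm p.2]]
            | r in [set r : R | 0 < r]].

End MetricGroup.

Definition uniquely_2_divisible (X : zmodType) : Prop :=
  forall x : X, exists! z : X, z *+ 2 = x.

(* The default value 0 is never used when X is uniquely 2-divisible. *)
Definition halfg (X : zmodType) (x : X) : X := xget 0 [set z : X | z *+ 2 = x].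

(* Main.v *)
(** Write J x y := 2 f((x + y)/2) - f x - f y. For every z,
    2 J x y = J (x + z) (y - z) + J (x - z) (y + z)
              - J (x + z) (x - z) - J (y + z) (y - z).
    When ||2z|| is large, the arguments of each J on the right are far from 0
    and far from each other, so the four terms are small, and 2 J x y = 0. *)
Require Import Defs.
From mathcomp Require Import all_boot all_order all_algebra.
From mathcomp Require Import all_classical all_reals all_analysis.
From mathcomp Require Import lra.

Import Order.TTheory GRing.Theory Num.Theory.
Import numFieldNormedType.Exports.

Local Open Scope classical_set_scope.
Local Open Scope ring_scope.

Section Dnorm.
Context {R : realType} {X : zmodType} {d : X -> X -> R}.
Hypothesis Xd : metric_group d.

Lemma dnorm_eq0 (x : X) : dnorm d x = 0 -> x = 0.
Proof. exact: (dist_positivity Xd). Qed.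

Lemma dnormN (x : X) : dnorm d (- x) = dnorm d x.
Proof.
by rewrite /dnorm -[LHS](dist_translation Xd x) addNr add0r (dist_sym Xd).
Qed.

Lemma ler_dnormD (x y : X) : dnorm d (x + y) <= dnorm d x + dnorm d y.
Proof.
apply: (le_trans (dist_triangle Xd y _ _)); rewrite lerD2r.
by rewrite -{2}[y]add0r (dist_translation Xd).
Qed.

Lemma ler_dnormB (x y : X) : dnorm d (x - y) <= dnorm d x + dnorm d y.
Proof. by rewrite -(dnormN y) ler_dnormD. Qed.

Lemma lerB_dnormD (x y : X) : dnorm d y - dnorm d x <= dnorm d (x + y).
Proof.
by rewrite lerBlDr -{1}[y](addrK x) [y + x]addrC ler_dnormB.
Qed.

Lemma dnorm_ge0 (x : X) : 0 <= dnorm d x.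
Proof.
have := ler_dnormB x x; rewrite subrr /dnorm (dist_xx Xd) => h.
by lra.
Qed.

Lemma double_unbounded_ge (M : R) :
  double_unbounded d -> exists z : X, M <= dnorm d (z *+ 2).
Proof.
move=> unb; have : (M%:E < +oo)%E by exact: ltry.
rewrite -unb => /ereal_sup_gt[_ [z _ <-]].
by rewrite lte_fin => /ltW; exists z.
Qed.

Lemma limsup_min_dnorm_lty (F : X -> X -> R) :
  (limsup_min_dnorm d F < +oo)%E ->
  exists r C : R, forall x y, r <= dnorm d x -> r <= dnorm d y -> F x y <= C.
Proof.
move=> /ereal_inf_lt[_ [r _ <-]].
set S := [set _ | _ in _] => Soo.
(* [fine] loses nothing: the supremum is below [+oo] by [Soo], and the value [F x y] in [S] keeps it
   above [-oo]. *)
exists r, (fine (ereal_sup S)) => x y rx ry.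
have FS : ((F x y)%:E <= ereal_sup S)%E.
  by apply: ereal_sup_ubound; exists (x, y).
by case: (ereal_sup S) Soo FS.
Qed.

End Dnorm.

Section Jensen.
Context {X Y : zmodType}.
Implicit Types (f : X -> Y) (x y z : X).

Definition jensen f x y : Y := f (halfg (x + y)) *+ 2 - f x - f y.

Lemma halfgK x : uniquely_2_divisible X -> halfg (x + x) = x.
Proof.
move=> divX; have [w [_ wP]] := divX (x + x).
have xP : x *+ 2 = x + x by rewrite mulr2n.
apply: (xget_unique _ xP) => z zP.
by rewrite -(wP _ zP) -(wP _ xP).
Qed.

(** Both added terms have midpoint (x + y)/2; the subtracted ones have midpoints x and y. The values
    of [f] at x + z, x - z, y + z, y - z occur once in each group and cancel. *)
Lemma jensen_shift f x y z : uniquely_2_divisible X ->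
  f (halfg (x + y)) *+ 4 - (f x *+ 2 + f y *+ 2) =
  (jensen f (x + z) (y - z) + jensen f (x - z) (y + z))
  - (jensen f (x + z) (x - z) + jensen f (y + z) (y - z)).
Proof.
move=> divX; rewrite /jensen.
have Bz a b : a + z + (b - z) = a + b by rewrite addrACA subrr addr0.
have Dz a b : a - z + (b + z) = a + b by rewrite addrACA addNr addr0.
rewrite !Bz !Dz !halfgK// (mulrnDr _ 2 2).
move: (f (halfg _) *+ 2) (f x *+ 2) (f y *+ 2) => m u v.
move: (f (x + z)) (f (x - z)) (f (y + z)) (f (y - z)) => a b a' b'.
have subD (p q r : Y) : p - q - r = p - (q + r) by rewrite opprD addrA.
have subDD (p q r t : Y) : (p - q) + (r - t) = (p + r) - (q + t).
  by rewrite opprD addrACA.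
rewrite !subD !subDD [a + b' + _]addrACA [b' + a']addrC.
by move: (_ + _ + (_ + _)) => s; rewrite opprB addrA subrK.
Qed.

End Jensen.

(** Far from 0 the product of [phi] and the defect stays bounded, so a large value of [phi] forces a
    small defect. *)
Lemma jensen_small {R : realType} {X Y : zmodType} {d : X -> X -> R}
    {rho : Y -> Y -> R} {phi : R -> R} {f : X -> Y} {e : R} :
    metric_group rho -> phi t @[t --> +oo] --> +oo ->
    (limsup_min_dnorm d (fun x y : X =>
      phi (dnorm d (x - y)) * dnorm rho (jensen f x y))%R < +oo)%E ->
    0 < e ->
  exists M : R, forall x y, M <= dnorm d x -> M <= dnorm d y ->
    M <= dnorm d (x - y) -> dnorm rho (jensen f x y) <= e.
Proof.
move=> Yrho /cvgryPge phioo /limsup_min_dnorm_lty[r [C FC]] e0.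
(* The bound [C] may be zero or negative; [|C| + 1] is a positive substitute. *)
have [s [_ sP]] := phioo ((`|C| + 1) / e).
(* [sP] needs a distance strictly above [s], hence [s + 1]. *)
exists (Num.max r (s + 1)) => x y; rewrite !ge_max.
move=> /andP[rx _] /andP[ry _] /andP[_ sxy].
have /sP : s < dnorm d (x - y) by lra.
have := FC x y rx ry; set p := phi _; set n := dnorm rho _ => pn Kp.
have n0 : 0 <= n by exact: dnorm_ge0.
have C0 : 0 < `|C| + 1 by rewrite ltr_wpDl.
(* The chain is (|C| + 1)/e * n <= p * n <= C <= |C| + 1. *)
rewrite -(ler_pM2l C0) -ler_pdivrMr// mulrAC.
apply: (le_trans (ler_wpM2r n0 Kp)); apply: (le_trans pn).
by have := ler_norm C; lra.
Qed.

(* phi is defined on [0, +oo[ only: its values at negative reals are irrelevant,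
   since dnorm is nonnegative and the limit is taken at +oo *)
Theorem theorem6 (R : realType)
    (X : zmodType) (d : X -> X -> R) (Xd : metric_group d)
    (Y : zmodType) (rho : Y -> Y -> R) (Yrho : metric_group rho)
    (divX : uniquely_2_divisible X) (unbX : double_unbounded d)
    (phi : R -> R) (phioo : phi t @[t --> +oo] --> +oo)
    (f : X -> Y)
    (limsupf : (limsup_min_dnorm d (fun x y : X =>
        phi (dnorm d (x - y)) *
        dnorm rho (f (halfg (x + y)) *+ 2 - f x - f y))%R < +oo)%E) :
  forall x y : X, f (halfg (x + y)) *+ 4 = f x *+ 2 + f y *+ 2.
Proof.
move=> x y; apply/eqP; rewrite -subr_eq0; apply/eqP/(dnorm_eq0 Yrho)/eqP.
rewrite eq_le (dnorm_ge0 Yrho) andbT; apply/ler_addgt0Pl => e e0.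
rewrite addr0; have e4 : 0 < e / 4 by lra.
have [M MP] := jensen_small Yrho phioo limsupf e4.
(* Subadditivity gives only ||z|| >= ||2z||/2, hence the factor 2: then ||z|| exceeds |M| by at
   least ||x|| + ||y||, which keeps all four shifted points far from 0. *)
have [z zM] := double_unbounded_ge
  (2 * (`|M| + dnorm d x + dnorm d y)) unbX.
have := ler_norm M; have := normr_ge0 M => M0 MM.
have x0 := dnorm_ge0 Xd x; have y0 := dnorm_ge0 Xd y.
have z2 : dnorm d (z *+ 2) <= dnorm d z + dnorm d z.
  by rewrite mulr2n ler_dnormD.
have far a w : dnorm d w - dnorm d a <= dnorm d (a + w) by exact: lerB_dnormD.
have Nz : dnorm d (- z) = dnorm d z by exact: dnormN.
have xDz : M <= dnorm d (x + z) by have := far x z; lra.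
have yDz : M <= dnorm d (y + z) by have := far y z; lra.
have xBz : M <= dnorm d (x - z) by have := far x (- z); lra.
have yBz : M <= dnorm d (y - z) by have := far y (- z); lra.
have xy := ler_dnormB Xd x y.
(* The arguments of each defect differ by x - y + 2z, x - y - 2z or, when a = b, exactly 2z; so
   their separation comes from ||2z||. *)
have subDB a b : a + z - (b - z) = a - b + z *+ 2.
  by rewrite opprB [z - b]addrC addrACA mulr2n.
have subBD a b : a - z - (b + z) = a - b + - (z *+ 2).
  by rewrite opprD addrACA mulr2n opprD.
have J1 : dnorm rho (jensen f (x + z) (y - z)) <= e / 4.
  by apply: MP => //; rewrite subDB; have := far (x - y) (z *+ 2); lra.
have J2 : dnorm rho (jensen f (x - z) (y + z)) <= e / 4.
  apply: MP => //; rewrite subBD.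
  by have := far (x - y) (- (z *+ 2)); rewrite (dnormN Xd (z *+ 2)); lra.
have J3 : dnorm rho (jensen f (x + z) (x - z)) <= e / 4.
  by apply: MP => //; rewrite subDB subrr add0r; lra.
have J4 : dnorm rho (jensen f (y + z) (y - z)) <= e / 4.
  by apply: MP => //; rewrite subDB subrr add0r; lra.
rewrite (jensen_shift _ _ _ z divX).
apply: (le_trans (ler_dnormB Yrho _ _)).
have := ler_dnormD Yrho (jensen f (x + z) (y - z)) (jensen f (x - z) (y + z)).
have := ler_dnormD Yrho (jensen f (x + z) (x - z)) (jensen f (y + z) (y - z)).
by lra.
Qed.
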